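(* Let $q$ be a power of a prime $p$, and let $n=p_1^{e_1}\cdots p_s^{e_s}$, where $p_1,\dots,p_s$ are distinct odd primes different from $p$ and $e_1,\dots,e_s$ are positive integers. Fix a primitive root system $\eta=(\eta_1,\dots,\eta_s)$ modulo $n$. Then all the distinct $q$-cyclotomic cosets modulo $n$ are given by $$c_{n/q}(\eta_1^{x_1}\cdots\eta_s^{x_s}p_1^{y_1}\cdots p_s^{y_s})=\{\eta_1^{x_1}\cdots\eta_s^{x_s}p_1^{y_1}\cdots p_s^{y_s}\,q^{j}\ :\ 0\le j\le \tau_{y_1\cdots y_s}-1\}$$ (the listed elements of each coset being pairwise distinct modulo $n$, so that the coset has size $\tau_{y_1\cdots y_s}$), where the integers $y_i,x_i$ range (each tuple giving a different coset) over (1) $0\le y_i\le e_i$ for $i=1,\dots,s$; (2a) $0\le x_1\le g_{1,y_1}-1$; and (2b) $0\le x_i\le g_{i,y_i}\cdot\gcd(\mathrm{lcm}(f_{1,y_1},\dots,f_{i-1,y_{i-1}}),f_{i,y_i})-1$ for $i=2,\dots,s$.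
   Context: For $N\ge 1$ coprime to $q$ and $\gamma\in\mathbb{Z}/N\mathbb{Z}$ (or an integer $\gamma$, reduced mod $N$), the $q$-cyclotomic coset modulo $N$ containing $\gamma$ is $c_{N/q}(\gamma)=\{\gamma,\gamma q,\dots,\gamma q^{\tau-1}\}\subseteq\mathbb{Z}/N\mathbb{Z}$, where $\tau$ is the smallest positive integer with $\gamma q^{\tau}\equiv\gamma\pmod N$; its size is $\tau$. An $s$-tuple $\eta=(\eta_1,\dots,\eta_s)$ of integers is a primitive root system modulo $p_1^{e_1}\cdots p_s^{e_s}$ if for every $i$: $\eta_i$ is a primitive root modulo $p_i^{d}$ for all $d\ge1$, and $\eta_i\equiv1\pmod{p_j^{e_j}}$ for every $j\ne i$. Notation, for $0\le y_i\le e_i$: $f_{i,y_i}=\mathrm{ord}_{p_i^{e_i-y_i}}(q)$ (multiplicative order, with $\mathrm{ord}_1(q)=1$); $g_{i,y_i}=\phi(p_i^{e_i-y_i})/f_{i,y_i}$ with $\phi$ Euler's function; $\tau_{y_1\cdots y_s}=\mathrm{ord}_{p_1^{e_1-y_1}\cdots p_s^{e_s-y_s}}(q)=\mathrm{lcm}(f_{1,y_1},\dots,f_{s,y_s})$. *)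

(* Defs.v *)
From HB Require Import structures.
From mathcomp Require Import all_boot all_order all_algebra.
From mathcomp Require Import cyclic.

Set Implicit Arguments.
Unset Strict Implicit.
Unset Printing Implicit Defensive.

Import Order.TTheory GRing.Theory Num.Theory.

Local Open Scope ring_scope.

(* The smallest t with 0 < t <= B and P t (0 if there is none). *)
Definition least_pos (B : nat) (P : pred nat) : nat :=
  head 0%N [seq t <- iota 1 B | P t].

Lemma least_posP (B : nat) (P : pred nat) (t0 : nat) :
  (0 < t0 <= B)%N -> P t0 ->
  [/\ (0 < least_pos B P)%N, P (least_pos B P)
    & forall t : nat, (0 < t)%N -> P t -> (least_pos B P <= t)%N].
Proof.
move=> /andP[t0_gt0 t0B] Pt0; rewrite /least_pos.
set s := filter _ _.
have s_sorted : sorted leq s.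
  by apply: sorted_filter; [exact: leq_trans | exact: iota_sorted].
have memE t : (t \in s) = [&& P t, (0 < t)%N & (t <= B)%N].
  by rewrite mem_filter mem_iota add1n ltnS.
have : t0 \in s by rewrite memE Pt0 t0_gt0.
case: s s_sorted memE => [|a s] //= s_path memE t0s.
have := memE a; rewrite mem_head => /esym/and3P[Pa a_gt0 aB].
split=> // t t_gt0 Pt; have [tB|Bt] := leqP t B; last first.
  exact: leq_trans aB (ltnW Bt).
have : t \in a :: s by rewrite memE Pt t_gt0.
rewrite inE => /orP[/eqP -> //|ts].
by have /allP/(_ _ ts) := order_path_min leq_trans s_path.
Qed.

(* The multiplicative order ord_m(a); the search stops at totient m by
   Euler's theorem, see mult_orderP. In particular mult_order 1 a = 1. *)
Definition mult_order (m : nat) (a : int) : nat :=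
  least_pos (totient m) (fun t => (a ^+ t == 1 %[mod m%:Z])%Z).

Lemma mult_orderP (m : nat) (a : int) :
  (0 < m)%N -> coprimez a m%:Z ->
  [/\ (0 < mult_order m a)%N, (a ^+ mult_order m a = 1 %[mod m%:Z])%Z
    & forall t : nat, (0 < t)%N -> (a ^+ t = 1 %[mod m%:Z])%Z ->
      (mult_order m a <= t)%N].
Proof.
move=> m_gt0 co_am.
have [||o_gt0 /eqP oP o_min] :=
  @least_posP (totient m) (fun t => (a ^+ t == 1 %[mod m%:Z])%Z) (totient m).
- by rewrite totient_gt0 m_gt0 leqnn.
- have m_neq0 : m%:Z != 0 by rewrite -lt0n.
  rewrite -modzXm; have := modz_ge0 a m_neq0.
  have : coprimez (a %% m)%Z m%:Z by rewrite /coprimez gcdz_modl.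
  case: (a %% m)%Z => // b; rewrite coprimezE /= => co_bm _.
  apply/eqP; rewrite -[b%:Z]natz -natrX natz !modz_nat.
  by rewrite Euler_exp_totient.
- by split=> // t t_gt0 /eqP; apply: o_min.
Qed.

Definition primitive_root (m : nat) (a : int) : bool :=
  coprimez a m%:Z && (mult_order m a == totient m).

Definition primitive_root_system (s : nat) (p e : 'I_s -> nat)
    (eta : 'I_s -> int) : Prop :=
  forall i : 'I_s,
    (forall d : nat, (0 < d)%N -> primitive_root (p i ^ d) (eta i)) /\
    (forall j : 'I_s, j != i -> (eta i = 1 %[mod (p j ^ e j)%:Z])%Z).

(* 'Z_N is Z/NZ only for 1 < N, so the definitions below are meant for
   1 < N and q coprime to N. *)
Definition coset_size (N q : nat) (gamma : 'Z_N) : nat :=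
  least_pos (totient N) (fun t => gamma * q%:R ^+ t == gamma).

Lemma coset_sizeP (N q : nat) (gamma : 'Z_N) :
  (1 < N)%N -> coprime q N ->
  [/\ (0 < coset_size q gamma)%N,
      gamma * q%:R ^+ coset_size q gamma = gamma
    & forall t : nat, (0 < t)%N -> gamma * q%:R ^+ t = gamma ->
      (coset_size q gamma <= t)%N].
Proof.
move=> N_gt1 co_qN.
have [||o_gt0 /eqP oP o_min] := @least_posP (totient N)
  (fun t => gamma * q%:R ^+ t == gamma) (totient N).
- by rewrite totient_gt0 (ltnW N_gt1) leqnn.
- rewrite -natrX; apply/eqP; rewrite -[RHS]mulr1; congr (_ * _).
  apply: val_inj; rewrite /= -[1]/(1%:R) !val_Zp_nat // Zp_cast //.
  exact: Euler_exp_totient.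
- by split=> // t t_gt0 /eqP; apply: o_min.
Qed.

Definition cyclotomic_coset (N q : nat) (gamma : 'Z_N) : {set 'Z_N} :=
  [set gamma * q%:R ^+ (j : nat) | j : 'I_(coset_size q gamma)].

Definition cyclotomic_cosets (N q : nat) : {set {set 'Z_N}} :=
  [set cyclotomic_coset q gamma | gamma : 'Z_N].

Definition ford (s : nat) (p e : 'I_s -> nat) (q : nat) (y : 'I_s -> nat)
    (i : 'I_s) : nat :=
  mult_order (p i ^ (e i - y i)) q%:Z.

Definition gidx (s : nat) (p e : 'I_s -> nat) (q : nat) (y : 'I_s -> nat)
    (i : 'I_s) : nat :=
  (totient (p i ^ (e i - y i)) %/ ford p e q y i)%N.

Definition tau (s : nat) (p e : 'I_s -> nat) (q : nat) (y : 'I_s -> nat) : nat :=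
  mult_order (\prod_(i < s) p i ^ (e i - y i))%N q%:Z.

Definition representative (s : nat) (p : 'I_s -> nat) (eta : 'I_s -> int)
    (x y : 'I_s -> nat) : int :=
  (\prod_(i < s) eta i ^+ x i) * (\prod_(i < s) p i ^ y i)%N%:Z.

(* Indices start at 0, so the first index of the mathematical text is i = 0. *)
Definition admissible (s : nat) (p e : 'I_s -> nat) (q : nat)
    (x y : 'I_s -> nat) : Prop :=
  [/\ forall i : 'I_s, (y i <= e i)%N,
      forall i : 'I_s, (i : nat) = 0%N -> (x i < gidx p e q y i)%N
    & forall i : 'I_s, (0 < i)%N ->
        (x i < gidx p e q y i *
           gcdn (\big[lcmn/1%N]_(k < s | (k < i)%N) ford p e q y k) (ford p e q y i))%N].

(* Main.v *)
(* Prime by prime, representative x y is eta_i^(x_i) p_i^(y_i) times a unit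
   depending only on y, modulo p_i^(e_i). So a coset determines y, and for fixed
   y, writing q = eta_i^(a_i), the coset of x is its orbit under the
   simultaneous shifts x_i -> x_i + a_i j modulo m_i = phi(p_i^(e_i - y_i)).
   Here f_i = m_i / gcd(a_i, m_i) and g_i = gcd(a_i, m_i). The shifts fixing the
   coordinates before i are the multiples of L_i = lcm(f_k : k < i), and they
   move x_i by the multiples of gcd(a_i L_i, m_i) = g_i gcd(L_i, f_i); hence
   normalizing the coordinates one after the other leaves exactly one x in the
   stated box. *)
Require Import Defs.
From HB Require Import structures.
From mathcomp Require Import all_boot all_order all_algebra.
From mathcomp Require Import ring.

Set Implicit Arguments.
Unset Strict Implicit.
Unset Printing Implicit Defensive.

Import Order.TTheory GRing.Theory Num.Theory.

Local Open Scope ring_scope.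

(** * Congruences, multiplicative orders and discrete logarithms *)

Lemma eqz_modM (d a b a' b' : int) :
  (a = b %[mod d])%Z -> (a' = b' %[mod d])%Z -> (a * a' = b * b' %[mod d])%Z.
Proof. by move=> ab ab'; rewrite -modzMm ab ab' modzMm. Qed.

Lemma eqz_mod_dvdr (d d' a b : int) :
  (d %| d')%Z -> (a = b %[mod d'])%Z -> (a = b %[mod d])%Z.
Proof.
by move=> dd' /eqP ab; apply/eqP; move: ab; rewrite !eqz_mod_dvd; apply: dvdz_trans.
Qed.

Lemma eqz_mod_pmul2r (m : nat) (c a b : int) :
  coprimez c m%:Z -> (a * c == b * c %[mod m%:Z])%Z = (a == b %[mod m%:Z])%Z.
Proof.
by move=> co; rewrite !eqz_mod_dvd -mulrBl Gauss_dvdzl // coprimez_sym.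
Qed.

Lemma dvd_mult_order (m : nat) (a : int) (t : nat) :
  (0 < m)%N -> coprimez a m%:Z ->
  (a ^+ t == 1 %[mod m%:Z])%Z = (mult_order m a %| t)%N.
Proof.
move=> m_gt0 co; have [o_gt0 oE o_min] := mult_orderP m_gt0 co.
set o := mult_order m a in o_gt0 oE o_min *.
have X1 u : (a ^+ (o * u) = 1 %[mod m%:Z])%Z.
  by rewrite exprM -modzXm oE modzXm expr1n.
rewrite {1}(divn_eq t o) exprD (mulnC _ o) -modzMml X1 modzMml mul1r.
apply/eqP/idP => [H|/eqP ->]; last by rewrite expr0.
apply/negPn/negP => nd; have := o_min (t %% o)%N; rewrite lt0n => /(_ nd H).
by rewrite leqNgt ltn_pmod.
Qed.

Lemma eqz_mod_exp (m : nat) (a : int) (i j : nat) :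
  (0 < m)%N -> coprimez a m%:Z ->
  (a ^+ i == a ^+ j %[mod m%:Z])%Z = (i == j %[mod mult_order m a])%N.
Proof.
move=> m_gt0 co; wlog le_ji: i j / (j <= i)%N.
  move=> IH; have [|/ltnW] := leqP j i; first exact: IH.
  by move=> /IH; rewrite eq_sym => ->; rewrite eq_sym.
rewrite eqn_mod_dvd // -dvd_mult_order // -{1}(subnK le_ji) exprD.
by rewrite -{2}(mul1r (a ^+ j)) eqz_mod_pmul2r // /coprimez; apply: coprimezXl.
Qed.

(** Each cast equals that of the nonnegative residue modulo [N]. The bound on [N] matters: ['Z_0]
    and ['Z_1] have modulus 2. *)
Lemma eqz_Zp (N : nat) (a b : int) : (1 < N)%N ->
  (a%:~R == b%:~R :> 'Z_N) = (a == b %[mod N%:Z])%Z.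
Proof.
move=> N1; have N0 : N%:Z != 0 by rewrite -lt0n (ltnW N1).
have key (c : int) : (c%:~R : 'Z_N) = `|(c %% N%:Z)%Z|%N%:R.
  rewrite {1}(divz_eq c N%:Z) intrD intrM -!pmulrn pchar_Zp // mulr0 add0r.
  by rewrite -{1}(gez0_abs (modz_ge0 c N0)).
rewrite !key -!val_eqE /= !val_Zp_nat // !modn_small ?absz_nat.
- rewrite -eqz_nat !gez0_abs ?modz_ge0 //.
- by rewrite -ltz_nat gez0_abs ?modz_ge0 // ltz_pmod // ltz_nat ltnW.
- by rewrite -ltz_nat gez0_abs ?modz_ge0 // ltz_pmod // ltz_nat ltnW.
Qed.

(** Counting: the first [totient m] powers of [a] have distinct residues prime to [m], and there are
    only [totient m] such residues. *)
Lemma primitive_root_log (m : nat) (a b : int) :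
  (0 < m)%N -> primitive_root m a -> coprimez b m%:Z ->
  exists x : nat, (a ^+ x = b %[mod m%:Z])%Z.
Proof.
move=> m_gt0 /andP[co /eqP ord_a] co_b.
have m0 : m%:Z != 0 by rewrite -lt0n.
pose r (c : int) : nat := `|(c %% m%:Z)%Z|%N.
have rE c : (r c)%:Z = (c %% m%:Z)%Z by rewrite gez0_abs // modz_ge0.
have r_lt c : (r c < m)%N by rewrite -ltz_nat rE ltz_pmod.
have r_co c : coprimez c m%:Z -> coprime m (r c).
  by rewrite coprime_sym -[coprime _ _]/(coprimez (r c)%:Z m%:Z) rE /coprimez gcdz_modl.
pose U := [set i : 'I_m | coprime m i].
pose f (x : 'I_(totient m)) : 'I_m := Ordinal (r_lt (a ^+ x)).
have f_inj : injective f.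
  move=> x y /(congr1 val) /= /(congr1 Posz); rewrite !rE => /eqP.
  by rewrite eqz_mod_exp // ord_a !modn_small // => /eqP /val_inj.
have cardU : #|U| = totient m.
  rewrite totient_count_coprime big_mkord -sum1_card big_mkcond /=.
  by apply: eq_bigr => i _; rewrite inE; case: coprime.
have imU : f @: [set: 'I_(totient m)] = U.
  apply/eqP; rewrite eqEcard card_imset // cardsT card_ord cardU leqnn andbT.
  apply/subsetP => _ /imsetP[x _ ->]; rewrite inE /=.
  exact/r_co/coprimezXl.
have : Ordinal (r_lt b) \in U by rewrite inE r_co.
rewrite -imU => /imsetP[x _ /(congr1 val) /= /(congr1 Posz)]; rewrite !rE.
by move=> ?; exists x.
Qed.

Lemma primitive_root_log_mul (m : nat) (a b c : int) :
  (0 < m)%N -> primitive_root m a -> coprimez b m%:Z -> coprimez c m%:Z ->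
  exists x : nat, (a ^+ x * c = b %[mod m%:Z])%Z.
Proof.
move=> m_gt0 pr_a co_b co_c.
have [o_gt0 oE _] := mult_orderP m_gt0 co_c.
(* The factor [c ^+ (mult_order m c).-1] is the inverse of [c] modulo [m]. *)
have [|x xE] := primitive_root_log (b := b * c ^+ (mult_order m c).-1) m_gt0 pr_a.
  by rewrite coprimezMl co_b coprimezXl.
exists x; rewrite -modzMml xE modzMml -mulrA -exprSr prednK //.
by rewrite -modzMmr oE modzMmr mulr1.
Qed.

(** By Bezout [gcdn c m] is congruent to [- u * c], so adding [c] exactly [u * (z %/ gcdn c m)]
    times strips from [z] all full multiples of the gcd. *)
Lemma shift_mod_gcd (z c m : nat) : (0 < m)%N ->
  exists t x : nat, (x < gcdn c m)%N /\ (z + c * t = x %[mod m])%N.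
Proof.
move=> m_gt0; have [u _ mu] := Bezoutl c m_gt0; rewrite gcdnC in mu.
set g := gcdn c m in mu *.
have g_gt0 : (0 < g)%N by rewrite gcdn_gt0 m_gt0 orbT.
exists (u * (z %/ g))%N, (z %% g)%N; split; first by rewrite ltn_mod.
have -> : (z + c * (u * (z %/ g)) = (z %/ g) * (g + u * c) + z %% g)%N.
  by rewrite {1}(divn_eq z g); ring.
by rewrite -modnDml -modnMmr (eqP mu) muln0 mod0n add0n.
Qed.

(** * Normal forms of tuples under simultaneous shifts *)

Section Greedy.

Variables (s : nat) (m a : 'I_s -> nat).
Hypothesis m_gt0 : forall i, (0 < m i)%N.

(** The additive order of [a i] modulo [m i]. *)
Definition period (i : 'I_s) : nat := (m i %/ gcdn (a i) (m i))%N.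

Definition shift_bound (i : 'I_s) : nat :=
  (gcdn (a i) (m i) * gcdn (\big[lcmn/1%N]_(k < s | (k < i)%N) period k) (period i))%N.

Lemma dvdn_mul_period i j : (m i %| a i * j)%N = (period i %| j)%N.
Proof.
have g_gt0 : (0 < gcdn (a i) (m i))%N by rewrite gcdn_gt0 m_gt0 orbT.
rewrite -[RHS](dvdn_pmul2l g_gt0) /period (mulnC _ (_ %/ _)%N) divnK ?dvdn_gcdr //.
by rewrite muln_gcdl dvdn_gcd (dvdn_mulr _ (dvdnn (m i))) andbT.
Qed.

(** Multiplying the outer gcd into the inner one gives the gcd of [a i * L], [m i * L] and [m i],
    with [L] the lcm; the middle entry is a multiple of the last. *)
Lemma shift_boundE i :
  shift_bound i = gcdn (a i * \big[lcmn/1%N]_(k < s | (k < i)%N) period k) (m i).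
Proof.
have gp : (gcdn (a i) (m i) * period i = m i)%N.
  by rewrite mulnC divnK ?dvdn_gcdr.
rewrite /shift_bound muln_gcdr gp muln_gcdl -gcdnA; congr gcdn.
by apply/gcdn_idPr; rewrite dvdn_mulr.
Qed.

(** Once the coordinates before [i] agree, all earlier periods divide [j], so [shift_bound i]
    divides [a i * j]. It also divides [m i], hence [x i] and [x' i] agree modulo a number exceeding
    both. *)
Lemma shift_uniq (x x' : 'I_s -> nat) (j : nat) :
  (forall i, x i < shift_bound i)%N -> (forall i, x' i < shift_bound i)%N ->
  (forall i, x i + a i * j = x' i %[mod m i])%N -> forall i, x i = x' i.
Proof.
move=> xB x'B xx' i; have [r] := ubnP (i : nat).
elim: r i => // r IH i; rewrite ltnS => le_ir.
have dj : (\big[lcmn/1%N]_(k < s | (k < i)%N) period k %| j)%N.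
  apply/dvdn_biglcmP => k ki; rewrite -dvdn_mul_period /dvdn.
  have := xx' k; rewrite -(IH k (leq_trans ki le_ir)).
  by move/eqP; rewrite -{2}(addn0 (x k)) eqn_modDl mod0n.
have Bm : (shift_bound i %| m i)%N by rewrite shift_boundE dvdn_gcdr.
have Bj : (shift_bound i %| a i * j)%N.
  by apply: dvdn_trans (dvdn_mul (dvdnn (a i)) dj); rewrite shift_boundE dvdn_gcdl.
have /(congr1 (modn^~ (shift_bound i))) := xx' i; rewrite !modn_dvdm //.
by rewrite -modnDmr (eqP Bj) addn0 !modn_small.
Qed.

Lemma shift_exists (x : 'I_s -> nat) :
  exists (j : nat) (x' : 'I_s -> nat),
    (forall i, x' i < shift_bound i)%N /\
    (forall i, x i + a i * j = x' i %[mod m i])%N.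
Proof.
suff /(_ s) [j [x' H]] : forall r : nat, exists (j : nat) (x' : 'I_s -> nat),
    forall i : 'I_s, (i < r)%N ->
    (x' i < shift_bound i)%N /\ (x i + a i * j = x' i %[mod m i])%N.
  by exists j, x'; split=> i; case: (H i (ltn_ord i)).
elim=> [|r [j [x' H]]]; first by exists 0%N, x.
have [le_sr|lt_rs] := leqP s r.
  by exists j, x' => i _; apply: H; apply: leq_trans (ltn_ord i) le_sr.
pose i0 := Ordinal lt_rs; pose L := (\big[lcmn/1%N]_(k < s | (k < i0)%N) period k)%N.
(* The further shift is a multiple of [L], hence of every earlier period, so the coordinates already
   normalized stay fixed. *)
have [t [z [zB zE]]] := shift_mod_gcd (x i0 + a i0 * j) (a i0 * L) (m_gt0 i0).
exists (j + L * t)%N, (fun i => if i == i0 then z else x' i) => i.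
rewrite ltnS leq_eqVlt; have [-> _|ne] := eqVneq i i0.
  by rewrite shift_boundE; split=> //; rewrite mulnDr addnA mulnA.
case/orP=> [/eqP ir|ir]; first by rewrite -val_eqE /= ir eqxx in ne.
have [x'B x'E] := H i ir; split=> //; rewrite mulnDr addnA -modnDml x'E modnDml.
have /eqP mL : (m i %| a i * (L * t))%N.
  by rewrite dvdn_mul_period dvdn_mulr // /L (biglcmn_sup i).
by rewrite -modnDmr mL addn0.
Qed.

End Greedy.

(** * The Chinese remainder theorem for finite products *)

Lemma coprime_prodr (I : eqType) (r : seq I) (P : pred I) (m : I -> nat) (d : nat) :
  (forall i, P i -> coprime d (m i)) -> coprime d (\prod_(i <- r | P i) m i)%N.
Proof.
move=> co; apply: (big_ind (coprime d)); rewrite ?coprimen1 // => x y dx dy.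
by rewrite coprimeMr dx.
Qed.

Lemma eqz_mod_prod (s : nat) (m : 'I_s -> nat) (a b : int) :
  (forall i j, i != j -> coprime (m i) (m j)) ->
  (a == b %[mod (\prod_(i < s) m i)%N%:Z])%Z
    = [forall i, (a == b %[mod (m i)%:Z])%Z].
Proof.
move=> co; transitivity (all (fun i => a == b %[mod (m i)%:Z])%Z (index_enum 'I_s)).
  elim: (index_enum _) (index_enum_uniq 'I_s) => [|i r IH] /=.
    by move=> _; rewrite big_nil eqz_mod_dvd dvd1z.
  case/andP=> ir /IH {}IH; rewrite big_cons PoszM !eqz_mod_dvd Gauss_dvdz.
    by rewrite -!eqz_mod_dvd IH.
  rewrite coprimezE /= big_seq; apply: coprime_prodr => j jr; apply: co.
  by apply: contraNneq ir => ->.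
apply/allP/forallP => H i; first by apply: H; rewrite mem_index_enum.
by move=> _; apply: H.
Qed.

(** * Representatives modulo each prime power *)

Section RootSystem.

Variables (s : nat) (pr e : 'I_s -> nat) (eta : 'I_s -> int).
Hypothesis pr_prime : forall i, prime (pr i).
Hypothesis pr_inj : injective pr.
Hypothesis eta_root : primitive_root_system pr e eta.

Local Notation n := (\prod_(i < s) pr i ^ e i)%N.
Implicit Types x y : 'I_s -> nat.

Lemma coprime_pr_exp (f g : 'I_s -> nat) i j :
  i != j -> coprime (pr i ^ f i) (pr j ^ g j).
Proof.
move=> ij; apply/coprimeXl/coprimeXr.
by rewrite prime_coprime // dvdn_prime2 // (inj_eq pr_inj).
Qed.

Lemma pr_exp_gt0 i d : (0 < pr i ^ d)%N.
Proof. by rewrite expn_gt0 prime_gt0. Qed.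

(** Adds the exponent 0, which occurs as [e i - y i] when [y i = e i]; order and totient are then
    both 1. *)
Lemma primitive_root_pr i d : primitive_root (pr i ^ d) (eta i).
Proof.
case: d => [|d]; last exact: (eta_root i).1.
have co : coprimez (eta i) 1%:Z by rewrite coprimezE coprimen1.
rewrite expn0 /primitive_root co eqn_leq.
have [o_gt0 _ o_min] := mult_orderP (ltnSn 0) co.
by rewrite o_gt0 o_min // !modz1.
Qed.

Definition cofactor_at y i : int := (\prod_(j < s | j != i) pr j ^ y j)%N%:Z.

Lemma coprime_cofactor y i d : coprimez (cofactor_at y i) (pr i ^ d)%N%:Z.
Proof.
rewrite coprimez_sym coprimezE /=; apply: coprime_prodr => j ji.
by apply: (@coprime_pr_exp (fun=> d)); rewrite eq_sym.
Qed.

(** Modulo [pr i ^ e i] every [eta j] with [j != i] is 1, so only the power of [eta i] survives. The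
    free factor [b] makes room for powers of [q]. *)
Lemma representative_mulr_mod x y i (b : int) :
  (representative pr eta x y * b
     = eta i ^+ x i * cofactor_at y i * (pr i ^ y i)%N%:Z * b %[mod (pr i ^ e i)%N%:Z])%Z.
Proof.
rewrite /representative (bigD1 i) //= [X in X%:Z](bigD1 i) //= PoszM.
rewrite -/(cofactor_at y i); set B := \prod_(j < s | _) _.
have B1 : (B = 1 %[mod (pr i ^ e i)%N%:Z])%Z.
  apply: (big_ind (fun z => z = 1 %[mod (pr i ^ e i)%N%:Z])%Z) => // [u v u1 v1|j ji].
    by rewrite (eqz_modM u1 v1) mulr1.
  by rewrite -modzXm (eta_root j).2 1?eq_sym // modzXm expr1n.
rewrite [X in (X %% _)%Z = _](_ : _ = B * (eta i ^+ x i * cofactor_at y i * (pr i ^ y i)%N%:Z * b)).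
  by rewrite -modzMml B1 modzMml mul1r.
by ring.
Qed.

(** After splitting over [i], the unit cofactor cancels, and dividing both sides and the modulus by
    [pr i ^ y i] leaves the exponent [e i - y i]. *)
Lemma eqz_mod_representative x x' y (b c : int) : (forall i, y i <= e i)%N ->
  (representative pr eta x y * b == representative pr eta x' y * c %[mod n%:Z])%Z
    = [forall i, (eta i ^+ x i * b == eta i ^+ x' i * c
                    %[mod (pr i ^ (e i - y i))%N%:Z])%Z].
Proof.
move=> ye; rewrite eqz_mod_prod; last exact: coprime_pr_exp.
apply: eq_forallb => i; rewrite !representative_mulr_mod.
rewrite -[RHS](eqz_mod_pmul2r _ _ (coprime_cofactor y i _)) !eqz_mod_dvd.
rewrite -[in LHS](subnK (ye i)) expnD PoszM.
have p0 : (pr i ^ y i)%N%:Z != 0 by rewrite -lt0n pr_exp_gt0.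
rewrite -[RHS](dvdz_mul2r p0); congr dvdz; ring.
Qed.

(** [pr i ^ y' i] divides the modulus and the right side, hence the left side, where [pr i] occurs
    exactly [y i] times. *)
Lemma eqz_mod_representative_le x x' y y' i (b c : int) :
  (forall i, y' i <= e i)%N -> coprimez b (pr i)%:Z ->
  (representative pr eta x y * b = representative pr eta x' y' * c %[mod n%:Z])%Z ->
  (y' i <= y i)%N.
Proof.
move=> y'e co_b /eqP; rewrite eqz_mod_prod; last exact: coprime_pr_exp.
move=> /forallP /(_ i); rewrite !representative_mulr_mod.
have p_dvd : ((pr i ^ y' i)%N%:Z %| (pr i ^ e i)%N%:Z)%Z by apply: dvdn_exp2l.
rewrite eqz_mod_dvd => /(dvdz_trans p_dvd).
rewrite rpredBr; last by rewrite dvdz_mulr // dvdz_mull.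
rewrite mulrAC Gauss_dvdzr; first by rewrite dvdzE /= dvdn_Pexp2l // prime_gt1.
rewrite coprimez_sym !coprimezMl coprime_cofactor coprimezXl; last first.
  by case/andP: (primitive_root_pr i (y' i)).
by rewrite coprimezE /= coprimeXr.
Qed.

Variable q : nat.
Hypothesis q_coprime : forall i, coprime q (pr i).

Let coprime_q_exp i d : coprimez q%:Z (pr i ^ d)%N%:Z.
Proof. by rewrite coprimezE /= coprimeXr. Qed.

Lemma q_logs : exists a : 'I_s -> nat,
  forall i, (eta i ^+ a i = q%:Z %[mod (pr i ^ e i)%N%:Z])%Z.
Proof.
apply: (fin_all_exists (P := fun i a => (eta i ^+ a = q%:Z %[mod (pr i ^ e i)%N%:Z])%Z)).
by move=> i; apply: primitive_root_log; rewrite ?pr_exp_gt0 ?primitive_root_pr.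
Qed.

(** The valuation of [c] at [pr i] gives [y i]; a discrete logarithm of the remaining unit, divided
    by the cofactor, gives [x i]. *)
Lemma representative_surj (c : nat) : exists x y : 'I_s -> nat,
  (forall i, y i <= e i)%N /\ (representative pr eta x y = c%:Z %[mod n%:Z])%Z.
Proof.
have /fin_all_exists[y yP] i : exists y : nat, (y <= e i)%N /\
    exists2 v : nat, coprime v (pr i) & c = (v * pr i ^ y)%N %[mod pr i ^ e i].
  have [dv|ndv] := boolP (pr i ^ e i %| c)%N.
    (* Here [c] vanishes modulo [pr i ^ e i], so the exponent is capped at [e i] and the unit is
       taken to be 1; this includes [c = 0]. *)
    exists (e i); split=> //; exists 1%N; first exact: coprime1n.
    by rewrite mul1n modnn; apply/eqP.
  have c0 : (0 < c)%N by rewrite lt0n; apply: contraNneq ndv => ->.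
  have [v co_v cE] := pfactor_coprime (pr_prime i) c0.
  exists (logn (pr i) c); split; last by exists v; rewrite -?cE // coprime_sym.
  rewrite leqNgt; apply: contra ndv => /ltnW le_e.
  by rewrite cE dvdn_mull // dvdn_exp2l.
have /fin_all_exists[x xP] i : exists x : nat,
    (eta i ^+ x * cofactor_at y i * (pr i ^ y i)%N%:Z = c%:Z %[mod (pr i ^ e i)%N%:Z])%Z.
  have [_ [v co_v cE]] := yP i.
  have [||x xE] := primitive_root_log_mul (pr_exp_gt0 i (e i)) (primitive_root_pr i _)
    (b := v%:Z) (c := cofactor_at y i).
  - by rewrite coprimezE /= coprimeXr.
  - exact: coprime_cofactor.
  by exists x; rewrite -modzMml xE modzMml -PoszM !modz_nat cE.
exists x, y; split=> [i|]; first by have [] := yP i.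
apply/eqP; rewrite eqz_mod_prod; last exact: coprime_pr_exp.
by apply/forallP => i; rewrite -[representative _ _ _ _]mulr1 representative_mulr_mod mulr1 xP.
Qed.

(** The power of [eta i] cancels as a unit, leaving powers of [q] modulo the number that defines
    [tau]. *)
Lemma eqz_mod_representative_exp x y (j j' : nat) : (forall i, y i <= e i)%N ->
  (representative pr eta x y * q%:Z ^+ j == representative pr eta x y * q%:Z ^+ j'
     %[mod n%:Z])%Z = (j == j' %[mod tau pr e q y])%N.
Proof.
move=> ye; rewrite eqz_mod_representative // -eqz_mod_exp; first last.
- by rewrite coprimezE /=; apply: coprime_prodr => i _; apply: coprimeXr.
- by apply: prodn_gt0 => i; apply: pr_exp_gt0.
rewrite eqz_mod_prod; last exact: coprime_pr_exp.
apply: eq_forallb => i; rewrite !(mulrC (eta i ^+ x i)) eqz_mod_pmul2r //.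
by apply: coprimezXl; case/andP: (primitive_root_pr i (e i - y i)).
Qed.

(** * Translation into exponents through discrete logarithms of [q] *)

Section Logs.

Variable a : 'I_s -> nat.
Hypothesis a_log : forall i, (eta i ^+ a i = q%:Z %[mod (pr i ^ e i)%N%:Z])%Z.

Let phi y i := totient (pr i ^ (e i - y i)).

Let phi_gt0 y i : (0 < phi y i)%N.
Proof. by rewrite totient_gt0 pr_exp_gt0. Qed.

(** [q] may be replaced by [eta i ^+ a i] modulo a divisor of [pr i ^ e i], and exponents of [eta i]
    count modulo its order [phi y i]. *)
Lemma eqz_mod_eta_exp y i (x x' j : nat) :
  (eta i ^+ x * q%:Z ^+ j == eta i ^+ x' %[mod (pr i ^ (e i - y i))%N%:Z])%Z
    = (x + a i * j == x' %[mod phi y i])%N.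
Proof.
have /andP[co /eqP oE] := primitive_root_pr i (e i - y i).
rewrite /phi -oE -eqz_mod_exp ?pr_exp_gt0 // exprD exprM; congr (_ == _).
rewrite -modzMmr -modzXm.
rewrite -(@eqz_mod_dvdr _ (pr i ^ e i)%N%:Z _ _ _ (a_log i)) ?modzXm ?modzMmr //.
by apply: dvdn_exp2l; rewrite leq_subr.
Qed.

(** Both numbers have the same multiples [t]: [q ^ t] is 1 exactly when [phi y i] divides
    [a i * t]. *)
Lemma ford_period y i : ford pr e q y i = period (phi y) a i.
Proof.
have P t : (ford pr e q y i %| t)%N = (period (phi y) a i %| t)%N.
  rewrite -dvd_mult_order ?pr_exp_gt0 // -(dvdn_mul_period _ (phi_gt0 y)).
  by have := eqz_mod_eta_exp y i 0 0 t; rewrite !expr0 mul1r mod0n => ->.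
by apply/eqP; rewrite eqn_dvd P dvdnn -P dvdnn.
Qed.

Lemma gidx_gcdn y i : gidx pr e q y i = gcdn (a i) (phi y i).
Proof.
by rewrite /gidx ford_period /period divnA ?dvdn_gcdr // mulKn // phi_gt0.
Qed.

Lemma admissibleP x y : admissible pr e q x y <->
  (forall i, y i <= e i)%N /\ (forall i, x i < shift_bound (phi y) a i)%N.
Proof.
have B i : shift_bound (phi y) a i = (gidx pr e q y i *
    gcdn (\big[lcmn/1%N]_(k < s | (k < i)%N) ford pr e q y k) (ford pr e q y i))%N.
  by rewrite gidx_gcdn ford_period; under eq_bigr do rewrite ford_period.
(* At the first index the lcm is empty, hence 1, and the general bound reduces to [gidx]. *)
have B0 (i : 'I_s) : (i : nat) = 0%N -> shift_bound (phi y) a i = gidx pr e q y i.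
  by move=> i0; rewrite B big_pred0 => [|k]; rewrite ?gcd1n ?muln1 // i0.
split=> [[ye x0 xS]|[ye xB]]; split=> // i.
- by have [i0|i0] := posnP i; [rewrite B0 // x0 | rewrite B xS].
- by move=> i0; rewrite -B0.
- by rewrite -B.
Qed.

Lemma representative_shift x x' y (j : nat) : (forall i, y i <= e i)%N ->
  (representative pr eta x y * q%:Z ^+ j == representative pr eta x' y %[mod n%:Z])%Z
    = [forall i, x i + a i * j == x' i %[mod phi y i]]%N.
Proof.
move=> ye; rewrite -[representative pr eta x' y]mulr1 eqz_mod_representative //.
by apply: eq_forallb => i; rewrite mulr1 eqz_mod_eta_exp.
Qed.

End Logs.

End RootSystem.

(** * Cosets as full orbits of multiplication by [q] *)

Section Cosets.

Variables N q : nat.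
Hypotheses (N_gt1 : (1 < N)%N) (co_qN : coprime q N).

Lemma cyclotomic_cosetP (g h : 'Z_N) :
  reflect (exists t : nat, h = g * q%:R ^+ t) (h \in cyclotomic_coset q g).
Proof.
have [o_gt0 oE _] := coset_sizeP g N_gt1 co_qN.
apply: (iffP imsetP) => [[t _ ->]|[t ->]]; first by exists t.
exists (Ordinal (ltn_pmod t o_gt0)) => //=.
rewrite {1}(divn_eq t (coset_size q g)) exprD mulrA; congr (_ * _).
elim: (t %/ _)%N => [|u IH]; first by rewrite mulr1.
by rewrite mulSn exprD mulrA oE.
Qed.

Lemma mem_cyclotomic_coset (g : 'Z_N) : g \in cyclotomic_coset q g.
Proof. by apply/cyclotomic_cosetP; exists 0%N; rewrite mulr1. Qed.

Lemma cyclotomic_coset_shift (g : 'Z_N) t :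
  cyclotomic_coset q (g * q%:R ^+ t) = cyclotomic_coset q g.
Proof.
have [o_gt0 oE _] := coset_sizeP g N_gt1 co_qN.
apply/setP => h; apply/cyclotomic_cosetP/cyclotomic_cosetP => [[u ->]|[u ->]].
  by exists (t + u)%N; rewrite exprD mulrA.
(* As [coset_size] steps return to [g], multiplying by [q ^ t] another [coset_size - 1] times undoes
   the shift by [t]. *)
exists (t * (coset_size q g).-1 + u)%N.
rewrite -mulrA -exprD addnA -mulnS prednK // exprD mulrA; congr (_ * _).
by elim: t => [|t IH]; rewrite ?mulr1 // mulSn exprD mulrA oE.
Qed.

End Cosets.

(** * Classification and sizes of the cosets modulo [n] *)

Theorem theorem3p1 (p k q : nat) (hp : prime p) (hk : (0 < k)%N)
    (hq : q = (p ^ k)%N)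
    (s : nat) (hs : (0 < s)%N) (pr e : 'I_s -> nat)
    (hpr : forall i : 'I_s, [/\ prime (pr i), odd (pr i) & pr i != p])
    (hinj : injective pr) (he : forall i : 'I_s, (0 < e i)%N)
    (n : nat) (hn : n = (\prod_(i < s) pr i ^ e i)%N)
    (eta : 'I_s -> int) (heta : primitive_root_system pr e eta) :
  let rep (x y : {ffun 'I_s -> nat}) : 'Z_n :=
    (representative pr eta x y)%:~R in
  [/\ forall C : {set 'Z_n},
        C \in cyclotomic_cosets n q <->
        exists x y : {ffun 'I_s -> nat},
          admissible pr e q x y /\ C = cyclotomic_coset q (rep x y),
      forall x y x' y' : {ffun 'I_s -> nat},
        admissible pr e q x y -> admissible pr e q x' y' ->
        cyclotomic_coset q (rep x y) = cyclotomic_coset q (rep x' y') ->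
        x = x' /\ y = y'
    & forall x y : {ffun 'I_s -> nat}, admissible pr e q x y ->
        [/\ cyclotomic_coset q (rep x y)
              = [set rep x y * q%:R ^+ (j : nat) | j : 'I_(tau pr e q y)],
            injective (fun j : 'I_(tau pr e q y) => rep x y * q%:R ^+ (j : nat))
          & #|cyclotomic_coset q (rep x y)| = tau pr e q y]].
Proof.
have pr_prime i : prime (pr i) by have [] := hpr i.
have q_co i : coprime q (pr i).
  rewrite hq coprimeXl // prime_coprime // dvdn_prime2 // eq_sym.
  by have [_ _] := hpr i.
have co_qn : coprime q n.
  by rewrite hn; apply: coprime_prodr => i _; apply: coprimeXr.
(* This makes ['Z_n] the integers modulo [n]; the first prime power already exceeds 1. *)
have n_gt1 : (1 < n)%N.
  rewrite hn (bigD1 (Ordinal hs)) //=; set i0 := Ordinal hs.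
  apply: leq_trans (leq_pmulr _ _); last by apply: prodn_gt0 => i; apply: pr_exp_gt0.
  by rewrite -(exp1n (e i0)) ltn_exp2r ?prime_gt1.
have [a a_log] := q_logs pr_prime heta q_co.
pose phi (y : 'I_s -> nat) i := totient (pr i ^ (e i - y i)).
have phi_gt0 y i : (0 < phi y i)%N by rewrite totient_gt0 pr_exp_gt0.
move=> rep.
have repX x y j : rep x y * q%:R ^+ j = (representative pr eta x y * q%:Z ^+ j)%:~R.
  by rewrite intrM rmorphXn.
have rep_eqX (x y : {ffun 'I_s -> nat}) j j' : (forall i, y i <= e i)%N ->
    (rep x y * q%:R ^+ j == rep x y * q%:R ^+ j') = (j == j' %[mod tau pr e q y])%N.
  by move=> ye; rewrite !repX eqz_Zp // hn eqz_mod_representative_exp.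
have rep_shift (x x' y : {ffun 'I_s -> nat}) j : (forall i, y i <= e i)%N ->
    (rep x' y == rep x y * q%:R ^+ j)
      = [forall i, x i + a i * j == x' i %[mod phi y i]]%N.
  by move=> ye; rewrite repX eq_sym eqz_Zp // hn (representative_shift _ _ _ a_log).
split.
- move=> C; split=> [/imsetP[g _ ->]|[x [y [_ ->]]]]; last exact: imset_f.
  have [x [y [ye xyE]]] := representative_surj pr_prime hinj heta (val g); rewrite -hn in xyE.
  pose X := [ffun i => x i]; pose Y := [ffun i => y i].
  have Ye i : (Y i <= e i)%N by rewrite ffunE.
  have gE : rep X Y = g.
    transitivity ((val g)%:Z%:~R : 'Z_n); last exact: natr_Zp.
    apply/eqP; rewrite eqz_Zp // -xyE.
    rewrite /representative; under eq_bigr do rewrite ffunE.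
    by under [in X in _ * X]eq_bigr do rewrite ffunE.
  (* The exponents found may lie outside the box; multiplication by a power of [q] moves them inside
     and keeps the coset. *)
  have [j [x' [x'B x'E]]] := shift_exists a (phi_gt0 Y) X.
  exists [ffun i => x' i], Y; split.
    by apply/(admissibleP pr_prime heta q_co a_log); split=> // i; rewrite ffunE.
  rewrite (_ : rep [ffun i => x' i] Y = rep X Y * q%:R ^+ j).
    by rewrite cyclotomic_coset_shift // -gE.
  by apply/eqP; rewrite rep_shift //; apply/forallP => i; rewrite x'E ffunE.
- move=> x y x' y' /(admissibleP pr_prime heta q_co a_log)[ye xB].
  move=> /(admissibleP pr_prime heta q_co a_log)[y'e x'B] eqC.
  have : rep x' y' \in cyclotomic_coset q (rep x y).
    by rewrite eqC mem_cyclotomic_coset.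
  move=> /(cyclotomic_cosetP n_gt1 co_qn)[j jE].
  have yy' : y = y'.
    (* The factor 1 gives the right side the shape needed to compare valuations in both directions,
       since 1 and [q ^ j] are both prime to [pr i]. *)
    have: (representative pr eta x y * q%:Z ^+ j
        = representative pr eta x' y' * 1 %[mod n%:Z])%Z.
      by apply/eqP; rewrite mulr1 -eqz_Zp // -repX; apply/eqP/esym.
    rewrite hn => E; apply/ffunP => i; apply/eqP; rewrite eqn_leq.
    apply/andP; split.
      by apply: eqz_mod_representative_le (esym E) => //; rewrite coprimezE coprime1n.
    apply: eqz_mod_representative_le E => //.
    apply: coprimezXl; rewrite coprimezE; exact: q_co.
  rewrite -yy' in x'B jE *; split=> //.
  move/eqP: jE; rewrite rep_shift // => /forallP xx'.
  apply/ffunP; apply: (shift_uniq (phi_gt0 y) (a := a) (j := j)) => // i.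
  exact/eqP.
- move=> x y /(admissibleP pr_prime heta q_co a_log)[ye _].
  have inj : injective (fun j : 'I_(tau pr e q y) => rep x y * q%:R ^+ (j : nat)).
    by move=> j j' /eqP; rewrite rep_eqX // !modn_small // => /eqP /val_inj.
  have coset_tau : cyclotomic_coset q (rep x y)
      = [set rep x y * q%:R ^+ (j : nat) | j : 'I_(tau pr e q y)].
    have t_gt0 : (0 < tau pr e q y)%N.
      have [] // := @mult_orderP (\prod_(i < s) pr i ^ (e i - y i))%N q%:Z.
        by apply: prodn_gt0 => i; apply: pr_exp_gt0.
      by rewrite coprimezE; apply: coprime_prodr => i _; apply: coprimeXr.
    apply/setP => h; apply/(cyclotomic_cosetP n_gt1 co_qn)/imsetP => [[t ->]|[t _ ->]].
      exists (Ordinal (ltn_pmod t t_gt0)) => //=.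
      by apply/eqP; rewrite rep_eqX // modn_mod.
    by exists t.
  by split=> //; rewrite coset_tau card_imset // card_ord.
Qed.
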